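(* Let $\mathbb{F}_q$ be a finite field with $\mathrm{char}(\mathbb{F}_q)\neq 3$, let $V(\mathbb{F}_q)$ be the space of binary cubic forms over $\mathbb{F}_q$, and let $w_q\colon V(\mathbb{F}_q)\to\mathbb{C}$ be the function which sends $x$ to the number of roots of $x$ in $\mathbb{P}^1(\mathbb{F}_q)$. Then $$\widehat{w_q}(x)=\begin{cases}1+q^{-1} & x=0,\\ q^{-1} & x\neq 0 \text{ and } x \text{ has a triple root in } \mathbb{P}^1(\mathbb{F}_q),\\ 0 & \text{otherwise.}\end{cases}$$
   Context: $p=\mathrm{char}(\mathbb{F}_q)$. $V(\mathbb{F}_q)$ is the $4$-dimensional $\mathbb{F}_q$-vector space of binary cubic forms $x(u,v)=au^3+bu^2v+cuv^2+dv^3$, written $(a,b,c,d)$. A root of $x$ in $\mathbb{P}^1(\mathbb{F}_q)$ is a point at which $x$ vanishes; roots are counted as points of $\mathbb{P}^1(\mathbb{F}_q)$ (without multiplicity), so $w_q(0)=q+1$. The bilinear form on $V(\mathbb{F}_q)$ is $[x,x']=aa'+bb'/3+cc'/3+dd'$ for $x=(a,b,c,d)$, $x'=(a',b',c',d')$. For $\Phi\colon V(\mathbb{F}_q)\to\mathbb{C}$, its Fourier transform is $$\widehat{\Phi}(y)=q^{-4}\sum_{x\in V(\mathbb{F}_q)}\Phi(x)\exp\left(2\pi\sqrt{-1}\cdot\frac{\mathrm{Tr}_{\mathbb{F}_q/\mathbb{F}_p}([x,y])}{p}\right).$$ *)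

(* Defs.v *)
From HB Require Import structures.
From mathcomp Require Import all_boot all_order all_algebra all_field.
From mathcomp Require Import boolp reals sequences exp trigo.
From mathcomp Require Import complex.

Set Implicit Arguments.
Unset Strict Implicit.
Unset Printing Implicit Defensive.

Import Order.TTheory GRing.Theory Num.Theory.

Local Open Scope ring_scope.
Local Open Scope complex_scope.

Section BinaryCubicForms.
Variable F : finFieldType.

(* The row vector (a, b, c, d) encodes a u^3 + b u^2 v + c u v^2 + d v^3; as a
   bivariate polynomial, u is 'X (outer variable) and v is 'Y (inner one). *)
Definition binary_cubic (x : 'rV[F]_4) : {poly {poly F}} :=
  (x 0 0)%:P%:P * 'X ^+ 3 + (x 0 1)%:P%:P * 'X ^+ 2 * 'Y
  + (x 0 2)%:P%:P * 'X * 'Y ^+ 2 + (x 0 3)%:P%:P * 'Y ^+ 3.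

(* Points of P^1(F) are the lines through the origin of F^2. *)
Definition projline : {set {set 'rV[F]_2}} :=
  [set [set t *: P | t in [set: F]] | P : 'rV[F]_2 & P != 0].

Definition proots (x : 'rV[F]_4) : {set {set 'rV[F]_2}} :=
  [set L in projline |
    [forall P in L, (binary_cubic x).[P 0 0, P 0 1] == 0]].

(* The point [r : s] is the zero of the linear form s u - r v. *)
Definition has_triple_root (x : 'rV[F]_4) : Prop :=
  exists2 P : 'rV[F]_2, P != 0 &
  exists g : {poly {poly F}},
    binary_cubic x =
      g * ((P 0 1)%:P%:P * 'X - (P 0 0)%:P%:P * 'Y) ^+ 3.

Definition cubic_pairing (x y : 'rV[F]_4) : F :=
  x 0 0 * y 0 0 + x 0 1 * y 0 1 / 3 + x 0 2 * y 0 2 / 3 + x 0 3 * y 0 3.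

Section Trace.
Variables (p : nat) (charFp : p \in [pchar F]).

(* galTrace takes values in the prime subfield 1%AS of F; this is the
   corresponding element of 'F_p. *)
Definition absolute_trace (a : F) : 'F_p :=
  let L := pPrimeCharType charFp in
  odflt 0 [pick k : 'F_p | k%:A == galTrace 1%AS {:L} (a : L)].

End Trace.

End BinaryCubicForms.

Section Fourier.
Variable R : realType.

Definition cexp (z : R[i]) : R[i] :=
  let: a +i* b := z in (expR a)%:C * (cos b +i* sin b).

Variables (F : finFieldType) (p : nat) (charFp : p \in [pchar F]).

(* An element of 'F_p coerces to its representative in {0, ..., p - 1}. *)
Definition fourier (Phi : 'rV[F]_4 -> R[i]) (y : 'rV[F]_4) : R[i] :=
  #|F|%:R ^- 4 *
  \sum_(x : 'rV[F]_4) Phi x *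
    cexp (2 * pi%:C * 'i%C *
          ((absolute_trace charFp (cubic_pairing x y) : nat)%:R / p%:R)).

Definition root_count (x : 'rV[F]_4) : R[i] := #|proots x|%:R.

End Fourier.

Arguments root_count : clear implicits.

(* Main.v *)
Require Import Defs.
From HB Require Import structures.
From mathcomp Require Import all_boot all_order all_algebra all_field.
From mathcomp Require Import boolp reals sequences exp trigo.
From mathcomp Require Import complex.
From mathcomp Require Import fingroup ring lra.

Set Implicit Arguments.
Unset Strict Implicit.
Unset Printing Implicit Defensive.

Import Order.TTheory GRing.Theory Num.Theory.

Local Open Scope ring_scope.
Local Open Scope complex_scope.

(** Write [q] for the cardinality of the field, [psi] for the additive
    character [a |-> exp (2 pi i Tr a / p)], and, for a vector [P = (r, s)], let
    [nu P] be the coefficient vector [(r^3, 3 r^2 s, 3 r s^2, s^3)] of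
    [(r u + s v)^3].  The factors 1/3 in the bilinear form are such that
    [[x, nu P]] is the value of the cubic form [x] at [P]
    ([cubic_pairing_cube]).

    Let [w(x)] be the number of roots of [x].  A root is a line containing
    [q - 1] nonzero vectors, so [(q - 1) w(x)] is the number of nonzero [P] with [[x, nu P] = 0]
    ([card_root_vectors]).  The condition [[x, nu P] = 0] is detected by
    [q^-1 \sum_t psi (t [x, nu P])]; after exchanging the sums, the sum over [x]
    of [psi ([x, y + t nu P])] is [q^4] or [0] according to whether
    [y + t nu P] vanishes or not.  Therefore [q (q - 1)] times the Fourier
    transform of [w] at [y] is the number of pairs [(P, t)] with [P] nonzero and
    [y + t nu P = 0] ([fourier_root_count]).

    It remains to count these pairs.  For [y = 0] they are the pairs with
    [t = 0], so there are [q^2 - 1] of them.  A nonzero [y] has a triple root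
    exactly when it is a multiple of some [nu P] ([has_triple_rootP]); without
    triple root there is no pair.  If [y = c nu P], the vectors [Q] with [nu Q]
    proportional to [y] lie on the line of [P], and each nonzero [Q] on that
    line determines [t], whence [q - 1] pairs. *)

(** * Roots of unity in the complex numbers *)

Definition unit_root (R : realType) (p : nat) : R[i] :=
  cos (pi *+ 2 / p%:R) +i* sin (pi *+ 2 / p%:R).

Lemma unit_rootX (R : realType) (p k : nat) :
  unit_root R p ^+ k =
    cos (pi *+ 2 * k%:R / p%:R) +i* sin (pi *+ 2 * k%:R / p%:R).
Proof.
elim: k => [|k IHk]; first by rewrite expr0 mulr0 mul0r cos0 sin0.
rewrite exprSr IHk /unit_root -natr1 mulrDr mulr1 mulrDl cosD sinD.
by apply/eqP; rewrite eq_complex /=; apply/andP; split; apply/eqP => //; ring.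
Qed.

Lemma unit_root_expn (R : realType) (p : nat) :
  (0 < p)%N -> unit_root R p ^+ p = 1.
Proof.
by move=> p_gt0; rewrite unit_rootX mulfK ?cos2pi ?sin2pi // pnatr_eq0 -lt0n.
Qed.

Lemma unit_root_neq1 (R : realType) (p k : nat) :
  (0 < k < p)%N -> unit_root R p ^+ k != 1.
Proof.
case/andP=> k_gt0 k_lt_p; rewrite unit_rootX eq_complex /= negb_and.
apply/orP; left.
have p_gt0 : (0 : R) < p%:R by rewrite ltr0n (leq_trans _ k_lt_p).
(* The half angle lies strictly between 0 and pi, where the sine is positive. *)
have -> : (pi : R) *+ 2 * k%:R / p%:R = (pi * (k%:R / p%:R)) *+ 2.
  by rewrite -mulrA; exact: mulrnAl.
set t : R := pi * _.
have sin_t : 0 < sin t.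
  apply: sin_gt0_pi; apply/andP; split.
    by rewrite mulr_gt0 ?pi_gt0 // divr_gt0 // ltr0n.
  by rewrite gtr_pMr ?pi_gt0 // ltr_pdivrMr // mul1r ltr_nat.
rewrite cos_mulr2n cos2sin2 lt_eqF //.
have : 0 < sin t ^+ 2 by rewrite exprn_gt0.
by lra.
Qed.

Lemma cexp_unit_root (R : realType) (p k : nat) :
  cexp (2 * pi%:C * 'i%C * (k%:R / p%:R)) = unit_root R p ^+ k.
Proof.
rewrite unit_rootX.
have -> : 2 * pi%:C * 'i%C * (k%:R / p%:R)
          = 0 +i* (pi *+ 2 * k%:R / p%:R) :> R[i].
  have -> : (k%:R / p%:R : R[i]) = (k%:R / p%:R : R)%:C.
    by rewrite rmorphM fmorphV !rmorph_nat.
  have -> : (2 : R[i]) = (2 : R)%:C by rewrite rmorph_nat.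
  apply/eqP; rewrite eq_complex /=.
  by apply/andP; split; apply/eqP; ring.
by rewrite /cexp expR0 mul1r.
Qed.

(** * The trace to the prime field *)

Section Trace.
Variables (F : finFieldType) (p : nat) (charFp : p \in [pchar F]).
Let L : splittingFieldType 'F_p := pPrimeCharType charFp.

(** The default value in the definition of the absolute trace is never reached:
    finite extensions are Galois, so traces lie in the prime subfield. *)
Lemma absolute_traceE (a : F) :
  (absolute_trace charFp a)%:A = galTrace 1%AS {:L} (a : L).
Proof.
rewrite /absolute_trace; case: pickP => [k /eqP //| no_k].
have /vlineP[k trE] : galTrace 1%AS {:L} (a : L) \in 1%VS.
  by apply: mem_galTrace; [apply: finField_galois; apply: sub1v | apply: memvf].
by have := no_k k; rewrite trE eqxx.
Qed.

Lemma absolute_traceD (a b : F) :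
  absolute_trace charFp (a + b)
    = absolute_trace charFp a + absolute_trace charFp b.
Proof.
have inj : injective (fun k : 'F_p => k%:A : L).
  by exact: (fmorph_inj (in_alg L)).
apply: inj; rewrite /= scalerDl !absolute_traceE.
exact: (raddfD (galTrace 1%AS {:L})).
Qed.

(** By Dedekind's independence of automorphisms, their sum is not identically
    zero. *)
Lemma absolute_trace_neq0 : exists a : F, absolute_trace charFp a != 0.
Proof.
have [a _ tr_a] : {a : L | a \in {:L}%VS &
    \sum_(s in 'Gal({:L} / 1)%g) (1 : L) * s a != 0}.
  apply/sig2W; apply: (@gal_independent_contra _ _ _ [in 'Gal({:L} / 1)%g] _ 1%g).
    exact: group1.
  exact: oner_neq0.
exists a; apply: contra_neq tr_a => tr0.
transitivity (galTrace 1%AS {:L} (a : L)).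
  by apply: eq_bigr => s _; rewrite mul1r.
by rewrite -absolute_traceE tr0 scale0r.
Qed.

End Trace.

(** * Orthogonality of additive characters *)

Section Character.
Variables (R : realType) (F : finFieldType) (p : nat).
Variable charFp : p \in [pchar F].

Definition additive_char (a : F) : R[i] :=
  unit_root R p ^+ (absolute_trace charFp a : nat).

(** The trace is read off as a representative between [0] and [p - 1], so that
    additivity only holds modulo [p]; the base is a [p]-th root of unity. *)
Lemma additive_charD (a b : F) :
  additive_char (a + b) = additive_char a * additive_char b.
Proof.
have p_pr := pcharf_prime charFp.
have root1 : unit_root R p ^+ (Zp_trunc (pdiv p)).+2 = 1.
  by rewrite Fp_cast // unit_root_expn // prime_gt0.
by rewrite /additive_char absolute_traceD -exprD /= expr_mod.
Qed.

Lemma additive_char_neq1 : exists a : F, additive_char a != 1.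
Proof.
have p_pr := pcharf_prime charFp.
have [a tr_a] := absolute_trace_neq0 charFp.
exists a; apply: unit_root_neq1; rewrite lt0n tr_a /=.
by rewrite -[X in (_ < X)%N](Fp_cast p_pr) ltn_ord.
Qed.

(** Translating the summation variable by [v0] multiplies the sum by
    [chi v0]. *)
Lemma sum_nontrivial_char (V : finZmodType) (chi : V -> R[i]) (v0 : V) :
  {morph chi : x y / x + y >-> x * y} -> chi v0 != 1 -> \sum_v chi v = 0.
Proof.
move=> chiD chi_v0; set S := \sum_v chi v.
have S_shift : S = chi v0 * S.
  rewrite {1}/S (reindex_inj (addrI v0)) mulr_sumr.
  by apply: eq_bigr => v _; rewrite chiD.
have : (chi v0 - 1) * S = 0 by rewrite mulrBl mul1r -S_shift subrr.
by move/eqP; rewrite mulf_eq0 subr_eq0 (negbTE chi_v0) => /eqP.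
Qed.

Lemma additive_char0 : additive_char (0 : F) = 1.
Proof.
have := absolute_traceD charFp 0 0; rewrite addr0 -[LHS]addr0.
by move/addrI=> tr0; rewrite /additive_char -tr0 expr0.
Qed.

Lemma sum_additive_char (c : F) :
  \sum_t additive_char (t * c) = (c == 0)%:R * #|F|%:R.
Proof.
have [->|c_neq0] := eqVneq c 0.
  rewrite mul1r -sumr_const; apply: eq_bigr => t _.
  by rewrite mulr0 additive_char0.
have [a a_neq1] := additive_char_neq1.
rewrite mul0r; apply: (@sum_nontrivial_char F _ (a / c)).
  by move=> s t; rewrite mulrDl additive_charD.
by rewrite divfK.
Qed.

End Character.

(** * Cubes of linear forms *)

Section Cubic.
Variable F : finFieldType.
Implicit Types (x y z : 'rV[F]_4) (P Q : 'rV[F]_2).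

Lemma row2P P Q : [/\ P 0 0 = Q 0 0 & P 0 1 = Q 0 1] <-> P = Q.
Proof.
split=> [[e0 e1] | -> //]; apply/rowP; case=> [[|[|i]] lt_i2] //.
- by rewrite (_ : Ordinal _ = 0) //; apply: val_inj.
- by rewrite (_ : Ordinal _ = 1) //; apply: val_inj.
Qed.

Lemma row4P x y :
  [/\ x 0 0 = y 0 0, x 0 1 = y 0 1, x 0 2 = y 0 2 & x 0 3 = y 0 3] <-> x = y.
Proof.
split=> [[e0 e1 e2 e3] | -> //]; apply/rowP.
case=> [[|[|[|[|i]]]] lt_i4] //.
- by rewrite (_ : Ordinal _ = 0) //; apply: val_inj.
- by rewrite (_ : Ordinal _ = 1) //; apply: val_inj.
- by rewrite (_ : Ordinal _ = 2) //; apply: val_inj.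
- by rewrite (_ : Ordinal _ = 3) //; apply: val_inj.
Qed.

(** The coefficients of [(r u + s v)^3] for [P = (r, s)]. *)
Definition linear_form_cube P : 'rV[F]_4 :=
  \row_(i < 4) [:: P 0 0 ^+ 3; 3 * (P 0 0 ^+ 2 * P 0 1);
                   3 * (P 0 0 * P 0 1 ^+ 2); P 0 1 ^+ 3]`_i.

Lemma binary_cubicE x (a b : F) :
  (binary_cubic x).[a, b] =
    x 0 0 * a ^+ 3 + x 0 1 * (a ^+ 2 * b) + x 0 2 * (a * b ^+ 2)
    + x 0 3 * b ^+ 3.
Proof. by rewrite /binary_cubic !hornerE. Qed.

Hypothesis three_neq0 : (3 : F) != 0.

(** The factors 1/3 of the pairing cancel the middle binomial coefficients of
    the cube, so pairing with cubes of linear forms is evaluation. *)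
Lemma cubic_pairing_cube x P :
  cubic_pairing x (linear_form_cube P) = (binary_cubic x).[P 0 0, P 0 1].
Proof.
rewrite binary_cubicE /cubic_pairing !mxE /=.
by field.
Qed.

Lemma cubic_pairingDl x x' y :
  cubic_pairing (x + x') y = cubic_pairing x y + cubic_pairing x' y.
Proof. by rewrite /cubic_pairing !mxE; field. Qed.

Lemma cubic_pairingDZr x y y' t :
  cubic_pairing x (y + t *: y') = cubic_pairing x y + t * cubic_pairing x y'.
Proof. by rewrite /cubic_pairing !mxE; field. Qed.

Lemma cubic_pairing_nondegenerate y a :
  y != 0 -> exists x, cubic_pairing x y = a.
Proof.
move=> y_neq0.
have [i yi_neq0] : exists i, y 0 i != 0.
  apply/existsP; apply: contra_neqT y_neq0; rewrite negb_exists => /forallP y0.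
  by apply/rowP=> i; rewrite mxE; apply/eqP; have := y0 i; rewrite negbK.
(* The weight is 1 on the outer coefficients and 1/3 on the inner ones. *)
have [w w_neq0 dual] : exists2 w : F, w != 0 &
    forall b, cubic_pairing (b *: delta_mx 0 i) y = b * (w * y 0 i).
  case: i {yi_neq0} => [[|[|[|[|i]]]] lt_i4] //;
    [exists 1|exists 3^-1|exists 3^-1|exists 1]; rewrite ?invr_eq0 ?oner_neq0 //;
    move=> b; rewrite /cubic_pairing !mxE /=; set j := Ordinal _.
  - by rewrite (_ : j = 0); [field|apply: val_inj].
  - by rewrite (_ : j = 1); [field|apply: val_inj].
  - by rewrite (_ : j = 2); [field|apply: val_inj].
  - by rewrite (_ : j = 3); [field|apply: val_inj].
exists ((a / (w * y 0 i)) *: delta_mx 0 i).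
by rewrite dual divfK // mulf_neq0.
Qed.

Lemma linear_form_cube_eq0 P : (linear_form_cube P == 0) = (P == 0).
Proof.
apply/eqP/eqP=> [P3 | ->]; last first.
  by apply/row4P; split; rewrite !mxE /=; ring.
have /row4P[] := P3; rewrite !mxE /= => /eqP r3 _ _ /eqP s3.
by apply/row2P; move: r3 s3; rewrite !mxE !expf_eq0 /= => /eqP-> /eqP->.
Qed.

Lemma linear_form_cubeZ u P :
  linear_form_cube (u *: P) = u ^+ 3 *: linear_form_cube P.
Proof. by apply/row4P; split; rewrite !mxE /=; ring. Qed.

(** The cubic form [(s u - r v)^3], where [P = (r, s)], pairs with
    [linear_form_cube Q] to the cube of the determinant of [P] and [Q], and with
    [linear_form_cube P] to zero. *)
Lemma linear_form_cube_collinear (c t : F) P Q :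
    t != 0 -> P != 0 -> t *: linear_form_cube Q = c *: linear_form_cube P ->
  exists u, Q = u *: P.
Proof.
move=> t_neq0 P_neq0 eqPQ.
have det0 : P 0 1 * Q 0 0 = P 0 0 * Q 0 1.
  have /row4P[] := eqPQ; rewrite !mxE /= => e0 e1 e2 e3.
  have : t * (P 0 1 * Q 0 0 - P 0 0 * Q 0 1) ^+ 3 = 0.
    (* The expansion of the cube, arranged to use the four coordinates. *)
    transitivity (P 0 1 ^+ 3 * (t * Q 0 0 ^+ 3)
       - P 0 1 ^+ 2 * P 0 0 * (t * (3 * (Q 0 0 ^+ 2 * Q 0 1)))
       + P 0 1 * P 0 0 ^+ 2 * (t * (3 * (Q 0 0 * Q 0 1 ^+ 2)))
       - P 0 0 ^+ 3 * (t * Q 0 1 ^+ 3)); first by ring.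
    by rewrite e0 e1 e2 e3; ring.
  move/eqP; rewrite mulf_eq0 (negbTE t_neq0) expf_eq0 /= subr_eq0.
  by move/eqP.
have [P0|P0] := eqVneq (P 0 0) 0; last first.
  exists (Q 0 0 / P 0 0); apply/row2P; rewrite !mxE divfK //; split=> //.
  by apply: (mulfI P0); rewrite -det0; field.
have P1 : P 0 1 != 0.
  by apply: contra_neq P_neq0 => P1; apply/row2P; rewrite !mxE.
exists (Q 0 1 / P 0 1); apply/row2P; rewrite !mxE divfK //; split=> //.
by apply: (mulfI P1); rewrite det0 P0 mul0r !mulr0.
Qed.

(** * Triple roots *)

(** A binary cubic form is homogeneous of degree 3, hence the degree 3 part of
    its multiple by [g] only involves the constant term of [g]. *)
Lemma coef_mul_binary_cubic (g : {poly {poly F}}) z :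
  [/\ (g * binary_cubic z)`_3`_0 = g`_0`_0 * z 0 0,
      (g * binary_cubic z)`_2`_1 = g`_0`_0 * z 0 1,
      (g * binary_cubic z)`_1`_2 = g`_0`_0 * z 0 2 &
      (g * binary_cubic z)`_0`_3 = g`_0`_0 * z 0 3].
Proof.
have -> : g * binary_cubic z =
    (z 0 0)%:P%:P * (('X^0)%:P * (g * 'X^3))
  + (z 0 1)%:P%:P * (('X^1)%:P * (g * 'X^2))
  + (z 0 2)%:P%:P * (('X^2)%:P * (g * 'X^1))
  + (z 0 3)%:P%:P * (('X^3)%:P * (g * 'X^0)).
  by rewrite /binary_cubic !rmorphXn /=; ring.
by split; rewrite !(coefD, coefCM, coefMXn, coefXnM) /=;
  rewrite ?(coef0, subn0, subnn); ring.
Qed.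

Lemma binary_cubic_eqM (g : {poly {poly F}}) y z :
  binary_cubic y = g * binary_cubic z -> y = g`_0`_0 *: z.
Proof.
rewrite -[LHS]mul1r => eq_yz.
have [y0 y1 y2 y3] := coef_mul_binary_cubic 1 y.
have [z0 z1 z2 z3] := coef_mul_binary_cubic g z.
rewrite eq_yz !coef1 !mul1r in y0 y1 y2 y3.
by apply/row4P; rewrite !mxE -z0 -z1 -z2 -z3 -y0 -y1 -y2 -y3.
Qed.

(** The linear form [s u - r v] vanishing at [(r, s)] is the one attached to the
    vector [(s, - r)]. *)
Lemma cube_of_vanishing_form P :
  ((P 0 1)%:P%:P * 'X - (P 0 0)%:P%:P * 'Y) ^+ 3 =
    binary_cubic (linear_form_cube (\row_(i < 2) [:: P 0 1; - P 0 0]`_i)).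
Proof.
rewrite /binary_cubic !mxE /= !(rmorphM, rmorphXn, rmorphN, rmorph_nat) /=.
by ring.
Qed.

Lemma binary_cubicZ c y : binary_cubic (c *: y) = c%:P%:P * binary_cubic y.
Proof. by rewrite /binary_cubic !mxE !rmorphM /=; ring. Qed.

(** The cofactor of the cube is a polynomial in two variables that may be
    replaced by its constant term.  The zero form has a triple root, with
    [c = 0]. *)
Lemma has_triple_rootP y :
  has_triple_root y <->
  exists P c, P != 0 /\ y = c *: linear_form_cube P.
Proof.
split=> [[P P_neq0 [g def_y]] | [P [c [P_neq0 ->]]]].
  exists (\row_(i < 2) [:: P 0 1; - P 0 0]`_i), (g`_0`_0); split.
    apply: contra_neq P_neq0 => /row2P[]; rewrite !mxE /= => s0 r0.
    by apply/row2P; rewrite !mxE s0 -[P 0 0]opprK r0 oppr0.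
  by apply: binary_cubic_eqM; rewrite -cube_of_vanishing_form.
exists (\row_(i < 2) [:: - P 0 1; P 0 0]`_i).
  apply: contra_neq P_neq0 => /row2P[]; rewrite !mxE /= => s0 r0.
  by apply/row2P; rewrite !mxE r0 -[P 0 1]opprK s0 oppr0.
exists c%:P%:P; rewrite binary_cubicZ cube_of_vanishing_form.
congr (_ * binary_cubic (linear_form_cube _)).
by apply/row2P; rewrite !mxE /= opprK.
Qed.

(** * From points of the projective line to vectors *)

Definition root_vectors x : {set 'rV[F]_2} :=
  [set P : 'rV[F]_2 | P != 0 & (binary_cubic x).[P 0 0, P 0 1] == 0].

Lemma horner_binary_cubicZ x t P :
  (binary_cubic x).[(t *: P) 0 0, (t *: P) 0 1] =
    t ^+ 3 * (binary_cubic x).[P 0 0, P 0 1].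
Proof. by rewrite !binary_cubicE !mxE; ring. Qed.

Definition line_of P : {set 'rV[F]_2} := [set t *: P | t in [set: F]].

Lemma line_of_eq P Q : Q != 0 -> Q \in line_of P -> line_of Q = line_of P.
Proof.
move=> Q_neq0 /imsetP[t _ QtP].
have t_neq0 : t != 0 by apply: contra_neq Q_neq0 => t0; rewrite QtP t0 scale0r.
apply/setP=> S; apply/imsetP/imsetP=> -[u _ ->].
  by exists (u * t) => //; rewrite QtP scalerA.
by exists (u / t) => //; rewrite QtP scalerA divfK.
Qed.

Lemma line_of_id P : P \in line_of P.
Proof. by apply/imsetP; exists 1; rewrite ?scale1r. Qed.

Lemma card_line_of P : P != 0 -> #|line_of P :\ 0| = #|F|.-1.
Proof.
move=> P_neq0.
have line0 : 0 \in line_of P by apply/imsetP; exists 0; rewrite ?scale0r.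
suff <- : #|line_of P| = #|F| by rewrite (cardsD1 0 (line_of P)) line0.
rewrite card_imset ?cardsT // => s t /eqP.
rewrite -subr_eq0 -scalerBl scaler_eq0 (negbTE P_neq0) orbF subr_eq0.
by move/eqP.
Qed.

Lemma line_of_proots x P : P != 0 ->
  (line_of P \in proots x) = (P \in root_vectors x).
Proof.
move=> P_neq0; rewrite !inE P_neq0 /=.
apply/andP/idP=> [[_ /forallP rootL] | rootP].
  by have := rootL P; rewrite line_of_id.
split; first by apply/imsetP; exists P; rewrite // inE.
apply/forallP=> Q; apply/implyP=> /imsetP[t _ ->].
by rewrite horner_binary_cubicZ (eqP rootP) mulr0.
Qed.

(** The nonzero zeros of [x] are partitioned by the lines that they span. *)
Lemma card_root_vectors x : #|root_vectors x| = (#|proots x| * #|F|.-1)%N.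
Proof.
rewrite -sum1_card (partition_big line_of [in proots x]) /=; last first.
  move=> P rootP; rewrite line_of_proots //.
  by move: rootP; rewrite !inE => /andP[].
rewrite -sum_nat_const; apply: eq_bigr => L rootL.
have [P P_neq0 LP] : exists2 P, P != 0 & L = line_of P.
  by move: rootL; rewrite !inE => /andP[/imsetP[P]]; rewrite inE; exists P.
rewrite -(card_line_of P_neq0) -LP -sum1_card; apply: eq_bigl => Q.
rewrite [RHS]in_setD1; apply/andP/andP=> [[rootQ /eqP<-] | [Q_neq0 QL]].
  by rewrite line_of_id; move: rootQ; rewrite !inE => /andP[].
have QP : line_of Q = L by rewrite LP; apply: line_of_eq; rewrite // -LP.
by rewrite -line_of_proots // QP.
Qed.

(** * Representations as multiples of cubes *)

Definition cube_solutions y : {set 'rV[F]_2 * F} :=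
  [set Pt : 'rV[F]_2 * F | Pt.1 != 0 & y + Pt.2 *: linear_form_cube Pt.1 == 0].

Lemma card_cube_solutions0 : #|cube_solutions 0| = (#|F| ^ 2).-1.
Proof.
have -> : cube_solutions 0 = setX [set~ 0] [set 0].
  apply/setP=> -[P t]; rewrite !inE /= add0r; case: eqVneq => //= P_neq0.
  by rewrite scaler_eq0 linear_form_cube_eq0 (negbTE P_neq0) orbF.
by rewrite cardsX cards1 muln1 cardsC1 card_mx mul1n.
Qed.

(** Starting from [y = c nu P], where [nu] stands for [linear_form_cube], the
    solutions are parametrized by the nonzero scalars [u] through
    [(u P, - c / u^3)]. *)
Lemma card_cube_solutions_triple y :
  y != 0 -> has_triple_root y -> #|cube_solutions y| = #|F|.-1.
Proof.
move=> y_neq0 /has_triple_rootP[P [c [P_neq0 def_y]]].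
have c_neq0 : c != 0.
  by apply: contra_neq y_neq0 => c0; rewrite def_y c0 scale0r.
have -> : cube_solutions y =
    [set (u *: P, - c / u ^+ 3) | u in [set~ (0 : F)]].
  apply/setP=> -[Q t]; rewrite inE /=; apply/andP/imsetP=> [[Q_neq0] | [u]].
    rewrite addrC addr_eq0 => /eqP eqQ.
    have t_neq0 : t != 0.
      by apply: contra_eq_neq eqQ => ->; rewrite scale0r eq_sym oppr_eq0.
    have [u def_Q] : exists u, Q = u *: P.
      apply: (@linear_form_cube_collinear (- c) t) => //.
      by rewrite eqQ def_y scaleNr.
    have u_neq0 : u != 0.
      by apply: contra_neq Q_neq0 => u0; rewrite def_Q u0 scale0r.
    exists u; rewrite ?inE // def_Q; congr (_, _).
    move: eqQ; rewrite def_Q def_y linear_form_cubeZ scalerA -scaleNr => /eqP.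
    rewrite -subr_eq0 -scalerBl scaler_eq0 linear_form_cube_eq0 (negbTE P_neq0).
    by rewrite orbF subr_eq0 => /eqP <-; rewrite mulfK // expf_neq0.
  rewrite !inE => u_neq0 [-> ->]; rewrite scaler_eq0 negb_or u_neq0 P_neq0.
  by rewrite linear_form_cubeZ scalerA divfK ?expf_neq0 // def_y scaleNr subrr.
rewrite card_in_imset ?cardsC1 // => u v _ _ [/eqP + _].
rewrite -subr_eq0 -scalerBl scaler_eq0 (negbTE P_neq0) orbF subr_eq0.
by move/eqP.
Qed.

Lemma card_cube_solutions_none y :
  ~ has_triple_root y -> #|cube_solutions y| = 0.
Proof.
move=> not_triple; apply/eqP; rewrite cards_eq0; apply/eqP/setP=> -[P t].
rewrite !inE /=; apply/negP=> /andP[P_neq0]; rewrite addr_eq0 => /eqP def_y.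
by apply/not_triple/has_triple_rootP; exists P, (- t); rewrite scaleNr.
Qed.

End Cubic.

(** * The Fourier transform of the root count *)

Section FourierRootCount.
Variables (R : realType) (F : finFieldType) (p : nat).
Variables (charFp : p \in [pchar F]) (three_neq0 : (3 : F) != 0).
Let psi := additive_char R charFp.
Implicit Types x y : 'rV[F]_4.

Lemma sum_char_pairing y :
  \sum_x psi (cubic_pairing x y) = (y == 0)%:R * #|F|%:R ^+ 4.
Proof.
have pairing0 x : cubic_pairing x 0 = 0.
  by rewrite /cubic_pairing !mxE; ring.
have [->|y_neq0] := eqVneq y 0.
  transitivity (\sum_(x : 'rV[F]_4) (1 : R[i])).
    by apply: eq_bigr => x _; rewrite pairing0 /psi additive_char0.
  by rewrite sumr_const card_mx mul1n natrX mul1r.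
have [a a_neq1] := additive_char_neq1 R charFp.
have [v pair_v] := cubic_pairing_nondegenerate three_neq0 a y_neq0.
rewrite mul0r; apply: (@sum_nontrivial_char _ 'rV[F]_4 _ v).
  by move=> x x'; rewrite cubic_pairingDl // /psi additive_charD.
by rewrite pair_v.
Qed.

Lemma fourier_root_count y :
  #|F|%:R * #|F|.-1%:R * fourier charFp (root_count R F) y =
    #|cube_solutions y|%:R.
Proof.
have q_neq0 : (#|F|%:R : R[i]) != 0.
  by rewrite pnatr_eq0 -lt0n (cardD1 (0 : F)).
rewrite /fourier.
have -> : \sum_(x : 'rV[F]_4) root_count R F x *
      cexp (2 * pi%:C * 'i%C *
        ((absolute_trace charFp (cubic_pairing x y) : nat)%:R / p%:R))
    = \sum_x #|proots x|%:R * psi (cubic_pairing x y).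
  by apply: eq_bigr => x _; rewrite cexp_unit_root.
suff main : #|F|%:R * #|F|.-1%:R *
    (\sum_x #|proots x|%:R * psi (cubic_pairing x y))
      = #|F|%:R ^+ 4 * #|cube_solutions y|%:R :> R[i].
  by rewrite mulrCA main mulKf // expf_neq0.
rewrite mulr_sumr.
transitivity (\sum_x \sum_(P : 'rV[F]_2 | P != 0) \sum_t
    psi (cubic_pairing x (y + t *: linear_form_cube P))).
  apply: eq_bigr => x _.
  transitivity (\sum_(P : 'rV[F]_2 | P != 0)
      ((binary_cubic x).[P 0 0, P 0 1] == 0)%:R * #|F|%:R
      * psi (cubic_pairing x y)).
    rewrite -!mulr_suml mulrA; congr (_ * _).
    rewrite -mulrA mulrC; congr (_ * _).
    rewrite mulrC -natrM -card_root_vectors -sum1_card natr_sum.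
    rewrite [LHS]big_mkcond [RHS]big_mkcond /=; apply: eq_bigr => P _.
    by rewrite inE; case: (P == 0) => //=; case: (_ == 0).
  apply: eq_bigr => P _; rewrite -(sum_additive_char R charFp) mulr_suml.
  apply: eq_bigr => t _.
  by rewrite cubic_pairingDZr // cubic_pairing_cube // /psi additive_charD mulrC.
rewrite exchange_big /=.
under eq_bigr => P _ do rewrite exchange_big /=.
rewrite pair_big_dep /=.
under eq_bigr => Pt _ do rewrite sum_char_pairing.
rewrite -mulr_suml mulrC; congr (_ * _).
rewrite -sum1_card natr_sum [LHS]big_mkcond [RHS]big_mkcond /=.
apply: eq_bigr => Pt _; rewrite inE; case: (Pt.1 == 0) => //=.
by case: (_ == 0).
Qed.

End FourierRootCount.

Theorem proposition1 (R : realType) (F : finFieldType) (p : nat)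
    (charFp : p \in [pchar F]) (p_neq3 : p != 3%N) (x : 'rV[F]_4) :
  fourier charFp (root_count R F) x =
    if x == 0 then 1 + (#|F|%:R)^-1
    else if `[< has_triple_root x >] then (#|F|%:R)^-1
    else 0.
Proof.
have three_neq0 : (3 : F) != 0.
  rewrite -(dvdn_pcharf charFp) dvdn_prime2 //; exact: pcharf_prime charFp.
have q_gt1 : (1 < #|F|)%N by apply: card_finRing_gt1.
have q_neq0 : (#|F|%:R : R[i]) != 0 by rewrite pnatr_eq0 -lt0n ltnW.
have q1_neq0 : (#|F|.-1%:R : R[i]) != 0.
  by rewrite pnatr_eq0 -lt0n -ltnS prednK // ltnW.
apply: (mulfI (mulf_neq0 q_neq0 q1_neq0)).
rewrite fourier_root_count //; have [->|x_neq0] := eqVneq x 0.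
  rewrite card_cube_solutions0.
  have -> : (#|F| ^ 2).-1 = (#|F|.-1 * (#|F| + 1))%N.
    by case: #|F| q_gt1 => // n _; rewrite -mulnn mulSn addSn /= addn1 [RHS]mulnS.
  by rewrite natrM natrD; field.
case: asboolP => [triple|not_triple].
  by rewrite card_cube_solutions_triple //; field.
by rewrite card_cube_solutions_none // mulr0.
Qed.
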